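(* For every integer $n\ge 1$ and every nonempty set $C$, the monoid $B^+_{n,C}$ is left cancellative and right cancellative.
   Context: For $n\ge 1$ and $C$ a nonempty set, $B^+_{n,C}$ (the monoid of positive $C$-colored braids) is the monoid with generators $\sigma_i^{(a)}$ for $1\le i\le n$ and $a\in C$, subject to the relations $$\sigma_i^{(a)}\sigma_j^{(b)}=\sigma_j^{(b)}\sigma_i^{(a)}\quad\text{for } |i-j|\ge 2,\ a,b\in C,$$ $$\sigma_i^{(a)}\sigma_j^{(b)}\sigma_i^{(c)}=\sigma_j^{(c)}\sigma_i^{(b)}\sigma_j^{(a)}\quad\text{for } |i-j|=1,\ a,b,c\in C.$$ *)

(* Defs.v *)
From HB Require Import structures.
From mathcomp Require Import all_boot ssrint boolp.

Set Implicit Arguments.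
Unset Strict Implicit.
Unset Printing Implicit Defensive.

Import IntDist.

Local Open Scope quotient_scope.
Local Open Scope group_scope.

Definition left_cancellative (M : magmaType) : Prop :=
  forall a x y : M, a * x = a * y -> x = y.

Definition right_cancellative (M : magmaType) : Prop :=
  forall a x y : M, x * a = y * a -> x = y.

Section PresentedMonoid.
Variables (G : Type) (R : seq G -> seq G -> Prop).

Inductive rel_congr : seq G -> seq G -> Prop :=
| rel_congr_rel p s u v : R u v -> rel_congr (p ++ u ++ s) (p ++ v ++ s)
| rel_congr_refl u : rel_congr u u
| rel_congr_sym u v : rel_congr u v -> rel_congr v u
| rel_congr_trans v u w : rel_congr u v -> rel_congr v w -> rel_congr u w.

Lemma rel_congr_cat u u' v v' :
  rel_congr u u' -> rel_congr v v' -> rel_congr (u ++ v) (u' ++ v').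
Proof.
have catl w x y : rel_congr x y -> rel_congr (w ++ x) (w ++ y).
  elim=> {x y} [p s x y xy|x|x y _|y x z _ xy _ yz].
  - by rewrite !(catA w); apply: rel_congr_rel.
  - exact: rel_congr_refl.
  - exact: rel_congr_sym.
  - exact: rel_congr_trans xy yz.
have catr w x y : rel_congr x y -> rel_congr (x ++ w) (y ++ w).
  elim=> {x y} [p s x y xy|x|x y _|y x z _ xy _ yz].
  - by rewrite -!catA; apply: rel_congr_rel.
  - exact: rel_congr_refl.
  - exact: rel_congr_sym.
  - exact: rel_congr_trans xy yz.
by move=> uu' vv'; apply: rel_congr_trans (catr _ _ _ uu') (catl _ _ _ vv').
Qed.

(* [G] has no decidable equality, so words get their choiceType structure
   from classical logic; {classic (seq G)} is convertible to seq G. *)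
Definition word := {classic (seq G)}.

Definition word_eqv : rel word := fun u v => `[< rel_congr u v >].

Lemma word_eqv_refl : reflexive word_eqv.
Proof. by move=> u; apply/asboolP/rel_congr_refl. Qed.

Lemma word_eqv_sym : symmetric word_eqv.
Proof. by move=> u v; apply/asboolP/asboolP => /rel_congr_sym. Qed.

Lemma word_eqv_trans : transitive word_eqv.
Proof.
move=> v u w /asboolP uv /asboolP vw; apply/asboolP.
exact: rel_congr_trans uv vw.
Qed.

Canonical word_equiv :=
  EquivRel word_eqv word_eqv_refl word_eqv_sym word_eqv_trans.

Definition presented_monoid : Type := {eq_quot word_equiv}.

HB.instance Definition _ := Choice.on presented_monoid.

Definition word_class (u : seq G) : presented_monoid :=
  \pi_({eq_quot word_equiv}) (u : word).

Definition class_word (x : presented_monoid) : seq G :=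
  repr (x : {eq_quot word_equiv}).

Lemma class_wordK : cancel class_word word_class.
Proof. by move=> x; rewrite /word_class /class_word reprK. Qed.

Lemma word_classP u v : word_class u = word_class v <-> rel_congr u v.
Proof.
split=> [/eqmodP/asboolP //|uv].
by apply/eqmodP/asboolP.
Qed.

Definition presented_one : presented_monoid := word_class [::].

Definition presented_mul (x y : presented_monoid) : presented_monoid :=
  word_class (class_word x ++ class_word y).

Lemma word_class_cat u v :
  presented_mul (word_class u) (word_class v) = word_class (u ++ v).
Proof.
by apply/word_classP; apply: rel_congr_cat; apply/word_classP/class_wordK.
Qed.

Lemma presented_mulA : associative presented_mul.
Proof.
move=> x y z; rewrite -(class_wordK x) -(class_wordK y) -(class_wordK z).
by rewrite !word_class_cat catA.
Qed.

Lemma presented_mul1 : left_id presented_one presented_mul.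
Proof. by move=> x; rewrite -(class_wordK x) word_class_cat. Qed.

Lemma presented_mulr1 : right_id presented_one presented_mul.
Proof. by move=> x; rewrite -(class_wordK x) word_class_cat cats0. Qed.

HB.instance Definition _ := isMonoid.Build presented_monoid
  presented_mulA presented_mul1 presented_mulr1.

Definition presented_gen (g : G) : presented_monoid := word_class [:: g].

Lemma word_class_prod (u : seq G) :
  word_class u = \prod_(g <- u) presented_gen g.
Proof.
elim: u => [|g u IHu]; first by rewrite big_nil.
by rewrite big_cons -IHu -[RHS]/(presented_mul _ _) word_class_cat.
Qed.

Lemma presented_rel (u v : seq G) : R u v ->
  \prod_(g <- u) presented_gen g = \prod_(g <- v) presented_gen g.
Proof.
move=> uv; rewrite -!word_class_prod; apply/word_classP.
by rewrite -[u]cats0 -[v]cats0; apply: (rel_congr_rel [::]).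
Qed.

End PresentedMonoid.

(* The letter (i, a) stands for sigma_(i+1)^(a): 'I_n is numbered from 0, and
   the relations depend only on the distance `|i - j| between indices. *)
Inductive braid_rel (n : nat) (C : Type) :
    seq ('I_n * C) -> seq ('I_n * C) -> Prop :=
| braid_rel_far (i j : 'I_n) (a b : C) : (2 <= `|i - j|)%N ->
    braid_rel [:: (i, a); (j, b)] [:: (j, b); (i, a)]
| braid_rel_near (i j : 'I_n) (a b c : C) : `|i - j|%N = 1%N ->
    braid_rel [:: (i, a); (j, b); (i, c)] [:: (j, c); (i, b); (j, a)].

Definition colored_braid_monoid (n : nat) (C : Type) : monoidType :=
  presented_monoid (@braid_rel n C).

Definition sigma (n : nat) (C : Type) (i : 'I_n) (a : C) :
    colored_braid_monoid n C :=
  presented_gen (@braid_rel n C) (i, a).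

Lemma sigma_far n (C : Type) (i j : 'I_n) (a b : C) : (2 <= `|i - j|)%N ->
  sigma i a * sigma j b = sigma j b * sigma i a.
Proof.
move=> ij; have := presented_rel (braid_rel_far a b ij).
by rewrite !big_cons !big_nil !mulg1.
Qed.

Lemma sigma_near n (C : Type) (i j : 'I_n) (a b c : C) : `|i - j|%N = 1%N ->
  sigma i a * sigma j b * sigma i c = sigma j c * sigma i b * sigma j a.
Proof.
move=> ij; have := presented_rel (braid_rel_near a b c ij).
by rewrite !big_cons !big_nil !mulg1 !mulgA.
Qed.

(* Main.v *)
(** Garside's argument, with colors carried along.  If
    [sigma i a * x = sigma j b * y], then [x] and [y] are forced: they agree
    when [(i, a) = (j, b)]; when [i] and [j] are far apart, resp. adjacent, they
    complete [sigma i a] and [sigma j b] to the two sides of a braid relation,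
    followed by a common factor.  The middle color of the braid relation is not
    determined by [a] and [b].  This property is clear for one application of
    a relation, and it is transitive along a chain of relations provided that it
    holds for shorter elements, so that it follows by induction on the length.
    Its diagonal case [(i, a) = (j, b)] is left cancellation by a generator.
    Right cancellation follows since the relations are stable under reversal
    of words. *)

Require Import Defs.
From mathcomp Require Import all_boot.
From mathcomp Require Import ssrint zify.

Set Implicit Arguments.
Unset Strict Implicit.
Unset Printing Implicit Defensive.

Import IntDist.

Local Open Scope group_scope.

(** * Presented monoids: reversal of words, and cancellation of generators *)

Section PresentedMonoidTheory.
Variables (G : Type) (R : seq G -> seq G -> Prop).

Lemma rel_congr_rev :
  (forall u v, R u v -> rel_congr R (rev u) (rev v)) ->
  forall u v, rel_congr R u v -> rel_congr R (rev u) (rev v).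
Proof.
move=> Rrev u v; elim=> {u v} [p s u v uv|u|u v _|v u w _ uv _ vw].
- rewrite !rev_cat; apply: rel_congr_cat; last exact: rel_congr_refl.
  by apply: rel_congr_cat; [exact: rel_congr_refl | exact: Rrev].
- exact: rel_congr_refl.
- exact: rel_congr_sym.
- exact: rel_congr_trans uv vw.
Qed.

Lemma presented_mulE u v :
  word_class R u * word_class R v = word_class R (u ++ v).
Proof. exact: word_class_cat. Qed.

Lemma presented_gen_class g u :
  presented_gen R g * word_class R u = word_class R (g :: u).
Proof. exact: presented_mulE. Qed.

Lemma presented_gen_left_cancellative :
  (forall g (x y : presented_monoid R),
     presented_gen R g * x = presented_gen R g * y -> x = y) ->
  left_cancellative (presented_monoid R).
Proof.
move=> cancel_gen c x y; rewrite -(class_wordK c).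
elim: (class_word c) => [|g u IHu]; first by rewrite -[word_class _ _]/(1 : presented_monoid R) !mul1g.
by rewrite -presented_gen_class -!mulgA => /cancel_gen /IHu.
Qed.

(** Reversal of words then respects the congruence, and it turns a common right factor into a common
    left one. *)
Lemma presented_right_cancellative :
  (forall u v, R u v -> rel_congr R (rev u) (rev v)) ->
  left_cancellative (presented_monoid R) ->
  right_cancellative (presented_monoid R).
Proof.
move=> /rel_congr_rev Rrev lcancel c x y.
rewrite -(class_wordK c) -(class_wordK x) -(class_wordK y) !presented_mulE.
move=> /word_classP/Rrev; rewrite !rev_cat => /word_classP.
rewrite -!presented_mulE => /lcancel/word_classP/Rrev.
by rewrite !revK => /word_classP.
Qed.

End PresentedMonoidTheory.

(** * Length of colored braids, and completions of two generators *)

Section ColoredBraid.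
Variables (n : nat) (C : Type).
Local Notation M := (colored_braid_monoid n C).
Local Notation class := (word_class (@braid_rel n C)).
Implicit Types (i j k : 'I_n) (a b c d e f : C) (x y z w t : M).

(** A far relation reverses to the one with [i] and [j] exchanged, a near one to the one with [a]
    and [c] exchanged. *)
Lemma braid_rel_rev (u v : seq ('I_n * C)) :
  braid_rel u v -> rel_congr (@braid_rel n C) (rev u) (rev v).
Proof.
move=> uv; rewrite -[rev u]cats0 -[rev v]cats0; apply: (rel_congr_rel [::]).
case: uv => [i j a b ij|i j a b c ij]; last exact: braid_rel_near.
by apply: braid_rel_far; rewrite distnC.
Qed.

Lemma rel_congr_size (u v : seq ('I_n * C)) :
  rel_congr (@braid_rel n C) u v -> size u = size v.
Proof.
elim=> {u v} [p s u v []|||] *; rewrite ?size_cat //=; congruence.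
Qed.

Definition braid_length x : nat := size (class_word x).

Lemma braid_length_class u : braid_length (class u) = size u.
Proof. by apply/rel_congr_size/word_classP/class_wordK. Qed.

Lemma braid_length_sigma i a x :
  braid_length (sigma i a * x) = (braid_length x).+1.
Proof.
rewrite -(class_wordK x) [_ * _]presented_gen_class.
by rewrite !braid_length_class.
Qed.

Lemma sigma_farA i j a b x : (2 <= `|i - j|)%N ->
  sigma i a * (sigma j b * x) = sigma j b * (sigma i a * x).
Proof. by move=> ij; rewrite !mulgA (sigma_far a b ij). Qed.

Lemma sigma_nearA i j a b c x : `|i - j|%N = 1%N ->
  sigma i a * (sigma j b * (sigma i c * x)) =
  sigma j c * (sigma i b * (sigma j a * x)).
Proof. by move=> ij; rewrite !mulgA (sigma_near a b c ij). Qed.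

Inductive completion : 'I_n -> C -> 'I_n -> C -> M -> M -> Prop :=
| completion_same i a x : completion i a i a x x
| completion_far i a j b z : (2 <= `|i - j|)%N ->
    completion i a j b (sigma j b * z) (sigma i a * z)
| completion_near i a j b d z : `|i - j|%N = 1%N ->
    completion i a j b (sigma j d * (sigma i b * z))
                       (sigma i d * (sigma j a * z)).

Lemma completion_sym i a j b x y :
  completion i a j b x y -> completion j b i a y x.
Proof.
by case=> *; constructor; rewrite // distnC.
Qed.

Variant dist_spec i j : Prop :=
| DistSame of i = j
| DistNear of `|i - j|%N = 1%N
| DistFar of (2 <= `|i - j|)%N.

Lemma distP i j : dist_spec i j.
Proof.
case E: `|i - j|%N => [|[|m]]; last by apply: DistFar; rewrite E.
- by apply/DistSame/val_inj/eqP; rewrite -distn_eq0 E.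
- exact: DistNear.
Qed.

Lemma completion_sameP i a b x y :
  completion i a i b x y -> a = b /\ x = y.
Proof.
move=> H; inversion H; subst => //; lia.
Qed.

Lemma completion_farP i j a b x y : (2 <= `|i - j|)%N ->
  completion i a j b x y ->
  exists z, x = sigma j b * z /\ y = sigma i a * z.
Proof.
move=> ij H; inversion H; subst; try lia.
by exists z.
Qed.

Lemma completion_nearP i j a b x y : `|i - j|%N = 1%N ->
  completion i a j b x y ->
  exists d z, x = sigma j d * (sigma i b * z) /\ y = sigma i d * (sigma j a * z).
Proof.
move=> ij H; inversion H; subst; try lia.
by exists d, z.
Qed.

Definition completion_below (L : nat) : Prop :=
  forall i a j b x y, (braid_length x < L)%N ->
  sigma i a * x = sigma j b * y -> completion i a j b x y.

(** * Transitivity of completion, by the position of the middle index [k] *)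

Section Transitivity.
Variable L : nat.
Hypothesis IH : completion_below L.

Lemma sigma_inj_lt i a b x y : (braid_length x < L)%N ->
  sigma i a * x = sigma i b * y -> a = b /\ x = y.
Proof. by move=> lx /(IH lx)/completion_sameP. Qed.

Lemma sigma_far_lt i j a b x y : (2 <= `|i - j|)%N -> (braid_length x < L)%N ->
  sigma i a * x = sigma j b * y ->
  exists z, x = sigma j b * z /\ y = sigma i a * z.
Proof. by move=> ij lx /(IH lx)/(completion_farP ij). Qed.

Lemma sigma_near_lt i j a b x y : `|i - j|%N = 1%N -> (braid_length x < L)%N ->
  sigma i a * x = sigma j b * y ->
  exists d z, x = sigma j d * (sigma i b * z) /\ y = sigma i d * (sigma j a * z).
Proof. by move=> ij lx /(IH lx)/(completion_nearP ij). Qed.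

(** The induction hypothesis completes [z] and [z']; since [sigma k c] commutes with both outer
    generators, it moves into the common factor. *)
Lemma completion_trans_far i j k a b c z z' :
  (2 <= `|i - k|)%N -> (2 <= `|k - j|)%N -> (braid_length z < L)%N ->
  sigma i a * z = sigma j b * z' ->
  completion i a j b (sigma k c * z) (sigma k c * z').
Proof.
move=> ik kj lz E; have ki : (2 <= `|k - i|)%N by rewrite distnC.
case: (distP i j) => [ij|ij|ij].
- subst j; have [-> ->] := sigma_inj_lt lz E; exact: completion_same.
- have [d [v [-> ->]]] := sigma_near_lt ij lz E.
  rewrite !(sigma_farA c _ _ kj) !(sigma_farA c _ _ ki) !(sigma_farA c _ _ kj).
  exact: completion_near.
- have [v [-> ->]] := sigma_far_lt ij lz E.
  rewrite (sigma_farA c _ _ kj) (sigma_farA c _ _ ki).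
  exact: completion_far.
Qed.

(** When [i] lies between [k] and [j], the common multiple is a colored half twist on four strands,
    of length six, times a remainder [s]. *)
Lemma completion_trans_near_far i j k a b c d z z' :
  `|i - k|%N = 1%N -> (2 <= `|k - j|)%N -> ((braid_length z).+1 < L)%N ->
  sigma i d * (sigma k a * z) = sigma j b * z' ->
  completion i a j b (sigma k d * (sigma i c * z)) (sigma k c * z').
Proof.
move=> ik kj lz E; have ki : `|k - i|%N = 1%N by rewrite distnC.
have lz1 : (braid_length z < L)%N by lia.
have lkz : (braid_length (sigma k a * z) < L)%N by rewrite braid_length_sigma.
case: (distP i j) => [ij|ij|ij]; first by subst j; lia.
- have [e [v [Ez ->]]] := sigma_near_lt ij lkz E.
  have [t [Ezt Evt]] := sigma_far_lt kj lz1 Ez.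
  have lv : (braid_length v < L)%N.
    move: (congr1 braid_length Ez); rewrite !braid_length_sigma; lia.
  have [f [s [-> Et]]] := sigma_near_lt ik lv Evt.
  rewrite Ezt Et.
  (* Both sides are brought to the near form with middle color [f] and common factor [sigma k e *
     (sigma i d * (sigma j c * s))]. *)
  rewrite (sigma_nearA c e f _ ij) (sigma_farA d f _ kj).
  rewrite -(sigma_farA b c _ kj) (sigma_nearA d e b _ ki).
  rewrite -(sigma_farA f d _ kj) (sigma_nearA c e f _ ki).
  rewrite (sigma_nearA c d a _ ij) (sigma_farA e a _ kj).
  exact: completion_near.
- have [v [Ez ->]] := sigma_far_lt ij lkz E.
  have [t [-> ->]] := sigma_far_lt kj lz1 Ez.
  rewrite (sigma_farA c b _ ij) (sigma_farA d b _ kj) (sigma_nearA c d a _ ki).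
  exact: completion_far.
Qed.

Lemma completion_trans_near i j k a b c d e z z' :
  `|i - k|%N = 1%N -> `|k - j|%N = 1%N -> ((braid_length z).+1 < L)%N ->
  sigma i d * (sigma k a * z) = sigma j e * (sigma k b * z') ->
  completion i a j b (sigma k d * (sigma i c * z)) (sigma k e * (sigma j c * z')).
Proof.
move=> ik kj lz E.
have jk : `|j - k|%N = 1%N by rewrite distnC.
have lz1 : (braid_length z < L)%N by lia.
have lkz : (braid_length (sigma k a * z) < L)%N by rewrite braid_length_sigma.
have lz' : (braid_length z' < L)%N.
  move: (congr1 braid_length E); rewrite !braid_length_sigma; lia.
case: (distP i j) => [ij|ij|ij]; last 1 first.
(* Here [k] lies between [i] and [j], and a colored half twist on four strands appears again. *)
- have [v [Ez Ez']] := sigma_far_lt ij lkz E.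
  have ji : (2 <= `|j - i|)%N by rewrite distnC.
  have ki : `|k - i|%N = 1%N by rewrite distnC.
  have [f [s [Ezs Ev]]] := sigma_near_lt kj lz1 Ez.
  have [g [t [Ez't Ev']]] := sigma_near_lt ki lz' Ez'.
  have lv : (braid_length v < L)%N.
    move: (congr1 braid_length Ez); rewrite !braid_length_sigma; lia.
  have ljs : (braid_length (sigma j a * s) < L)%N.
    move: (congr1 braid_length Ev); rewrite !braid_length_sigma; lia.
  have ls : (braid_length s < L)%N.
    by move: ljs; rewrite braid_length_sigma; lia.
  (* Both expressions for [v] start with index [k]: cancelling there forces the two middle colors to
     agree. *)
  move: Ev'; rewrite Ev => /(sigma_inj_lt ljs)[fg]; subst g.
  move=> /(sigma_far_lt ji ls)[u [Es Et]].
  rewrite Ezs Es Ez't Et.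
  rewrite (sigma_farA c f _ ij) (sigma_nearA c e b _ ik).
  rewrite (sigma_nearA d f b _ kj).
  rewrite (sigma_farA c f _ ji) (sigma_nearA c d a _ jk).
  rewrite (sigma_nearA e f a _ ki) (sigma_farA e d _ ij).
  exact: completion_far.
- subst j; have [-> /(sigma_inj_lt lz1)[-> ->]] := sigma_inj_lt lkz E.
  exact: completion_same.
(* Both [i] and [j] differ from [k] by one, so [|i - j|] is even. *)
- by lia.
Qed.

End Transitivity.

(** Unless one completion is [completion_same], each writes [w] as a generator times a shorter
    element, and the hypothesis applies to the resulting equation. *)
Lemma completion_trans i j k a b c x y w :
  completion_below (braid_length w) ->
  completion i a k c x w -> completion k c j b w y -> completion i a j b x y.
Proof.
move=> IH H1 H2; inversion H1; subst => //; inversion H2; subst => //.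
all: move: IH; rewrite braid_length_sigma => IH.
all: match goal with H : _ * _ = _ * _ |- _ => move/esym: H => E end.
all: have := congr1 braid_length E; rewrite !braid_length_sigma => lE.
- by apply: (completion_trans_far IH c _ _ _ E).
(* Far then near is near then far read from the other end. *)
- apply: completion_sym; apply: (completion_trans_near_far IH c _ _ _ (esym E)).
  + by rewrite distnC.
  + by rewrite distnC.
  + by lia.
- by apply: (completion_trans_near_far IH c _ _ _ E) => //; rewrite braid_length_sigma.
- by apply: (completion_trans_near IH c _ _ _ E) => //; rewrite braid_length_sigma.
Qed.

(** A relation acts at the front, or keeps the first letter and identifies the tails. The size
    hypothesis makes intermediate words nonempty, with tails of length [L] as [completion_trans]
    needs. *)
Lemma rel_congr_completion (L : nat) (u v : seq ('I_n * C)) :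
  completion_below L -> rel_congr (@braid_rel n C) u v -> size u = L.+1 ->
  forall i a j b u' v', u = (i, a) :: u' -> v = (j, b) :: v' ->
  completion i a j b (class u') (class v').
Proof.
move=> IH; elim=> {u v} [p s u v uv|u|u v uv IHuv|v u w uv IHuv vw IHvw] su i a j b u' v'.
- case: p su => [|h p] _ /=.
    case: uv => [k l c d kl|k l c d e kl] [<- <- <-] [<- <- <-];
      rewrite -!presented_gen_class; first exact: completion_far.
    exact: completion_near.
  move=> [-> <-] [<- <- <-].
  have -> : class (p ++ u ++ s) = class (p ++ v ++ s).
    by apply/word_classP/rel_congr_rel.
  exact: completion_same.
- by move=> -> [-> -> ->]; apply: completion_same.
- move=> Ev Eu; apply/completion_sym/IHuv => //.
  by rewrite (rel_congr_size uv).
- move=> Eu Ew; have sv : size v = L.+1 by rewrite -(rel_congr_size uv).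
  case: v sv uv IHuv vw IHvw => [|[k c] v] //= [sv] uv IHuv vw IHvw.
  apply: completion_trans (IHuv su _ _ _ _ _ _ Eu erefl)
    (IHvw _ _ _ _ _ _ _ erefl Ew); last by rewrite sv.
  by rewrite braid_length_class sv.
Qed.

Lemma sigma_completion i j a b x y :
  sigma i a * x = sigma j b * y -> completion i a j b x y.
Proof.
suff IH L : completion_below L by apply: (IH (braid_length x).+1).
elim: L => [//|L IHL] {}i {}a {}j {}b {}x {}y.
rewrite ltnS leq_eqVlt => /predU1P[lx|]; last exact: IHL.
rewrite -(class_wordK x) -(class_wordK y) ![sigma _ _ * _]presented_gen_class.
move=> /word_classP xy; apply: (rel_congr_completion IHL xy) => //=.
by rewrite -lx.
Qed.

Lemma colored_braid_left_cancellative : left_cancellative M.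
Proof.
apply: presented_gen_left_cancellative => -[i a] x y.
by move=> /sigma_completion/completion_sameP[].
Qed.

Lemma colored_braid_right_cancellative : right_cancellative M.
Proof.
apply: presented_right_cancellative; first exact: braid_rel_rev.
exact: colored_braid_left_cancellative.
Qed.

End ColoredBraid.

Theorem proposition2p2 (n : nat) (C : Type) (hn : (1 <= n)%N)
    (hC : inhabited C) :
  left_cancellative (colored_braid_monoid n C) /\
  right_cancellative (colored_braid_monoid n C).
Proof.
split; [exact: colored_braid_left_cancellative|].
exact: colored_braid_right_cancellative.
Qed.
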